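(* Suppose that $\phi''_F>0$, $\phi''_{2F}\in\mathbb{R}\setminus\{0\}$, and that $1\le p<\infty$ and $1<q\le\infty$ satisfy $\frac1p+\frac1q=1$. Then there exists a constant $C>0$ (independent of $N$ and $K$) such that, for all integers $N,K$ with $2\le K\le N/2$, $$\inf_{\substack{\mathbf{v}\in\mathcal{V}_0\\ \|D\mathbf{v}\|_{\ell^p_\epsilon}=1}}\ \sup_{\substack{\mathbf{w}\in\mathcal{V}_0\\ \|D\mathbf{w}\|_{\ell^q_\epsilon}=1}}\langle L^{qcf}\mathbf{v},\mathbf{w}\rangle\le C N^{-1/p}.$$
   Context: Let $\phi''_F := \phi''(F)$ and $\phi''_{2F} := \phi''(2F)$ be real numbers, where $\phi$ is an interatomic pair potential and $F>0$ (only these two real numbers enter). Let $N, K$ be integers with $0 < K < N-1$ and $\epsilon = 1/N$. Vectors $\mathbf{v}\in\mathbb{R}^{2N+1}$ are indexed by $j=-N,\dots,N$. The atomistic region is $\mathcal{A} = \{-K,\dots,K\}$ and the continuum region is $\mathcal{C} = \{-N+1,\dots,N-1\}\setminus\mathcal{A}$. The linearized force-based quasicontinuum (QCF) operator $L^{qcf}:\mathbb{R}^{2N+1}\to\mathbb{R}^{2N+1}$ is defined by $(L^{qcf}\mathbf{v})_{\pm N}=0$, $$(L^{qcf}\mathbf{v})_j = \phi''_F\,\frac{-v_{j+1}+2v_j-v_{j-1}}{\epsilon^2} + \phi''_{2F}\,\frac{-v_{j+2}+2v_j-v_{j-2}}{\epsilon^2}\quad\text{for } j\in\mathcal{A},$$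 $$(L^{qcf}\mathbf{v})_j = (\phi''_F+4\phi''_{2F})\,\frac{-v_{j+1}+2v_j-v_{j-1}}{\epsilon^2}\quad\text{for } j\in\mathcal{C}.$$ $\mathcal{V}_0 = \{\mathbf{v}\in\mathbb{R}^{2N+1}: v_{-N}=v_N=0\}$. The backward difference is $D\mathbf{v}=(Dv_j)_{j=-N+1}^{N}\in\mathbb{R}^{2N}$, $Dv_j = (v_j-v_{j-1})/\epsilon$. The inner product is $\langle\mathbf{v},\mathbf{w}\rangle = \sum_j \epsilon v_jw_j$; the norms are $\|\mathbf{v}\|_{\ell^p_\epsilon} = (\epsilon\sum_j |v_j|^p)^{1/p}$ for $1\le p<\infty$ and $\|\mathbf{v}\|_{\ell^\infty_\epsilon}=\max_j|v_j|$, over all indices of the vectors. *)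

(* Defs.v *)
From HB Require Import structures.
From mathcomp Require Import all_boot all_order all_algebra.
From mathcomp Require Import all_classical all_reals all_analysis.

Set Implicit Arguments.
Unset Strict Implicit.
Unset Printing Implicit Defensive.

Import Order.TTheory GRing.Theory Num.Theory.

Local Open Scope classical_set_scope.
Local Open Scope ring_scope.

(* A vector v = (v_j) with j = -N, ..., N is stored as a row vector of length
   2N+1 whose position i : 'I_(2N+1) holds the component of index j = i - N. *)
Definition gridvec (R : realType) (N : nat) := 'rV[R]_(N.*2.+1).

Definition mesh (R : realType) (N : nat) : R := N%:R^-1.

(* entry v j is v_j for -N <= j <= N; its value at other j is irrelevant. *)
Definition entry (R : realType) (N : nat) (v : gridvec R N) (j : int) : R :=
  v 0 (inord (absz (j + N%:Z))).

(* - v_(j+k) + 2 v_j - v_(j-k), over epsilon^2 *)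
Definition neg_diff2 (R : realType) (N : nat) (v : gridvec R N) (k j : int) : R :=
  (- entry v (j + k) + 2 * entry v j - entry v (j - k)) / mesh R N ^+ 2.

(* For K < N-1 the neighbours j +- 2 of an atomistic index j all lie in
   {-N, ..., N}. *)
Definition Lqcf (R : realType) (phiF phi2F : R) (N K : nat) (v : gridvec R N) :
    gridvec R N :=
  \row_i let j : int := (i : nat)%:Z - N%:Z in
    if (j == - N%:Z) || (j == N%:Z) then 0
    else if - K%:Z <= j <= K%:Z then
      phiF * neg_diff2 v 1 j + phi2F * neg_diff2 v 2 j
    else (phiF + 4 * phi2F) * neg_diff2 v 1 j.

Definition V0 (R : realType) (N : nat) : set (gridvec R N) :=
  [set v | entry v (- N%:Z) = 0 /\ entry v N%:Z = 0].

(* Position i : 'I_(2N) holds D v_j for j = i - N + 1, j = -N+1, ..., N. *)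
Definition bdiff (R : realType) (N : nat) (v : gridvec R N) : 'rV[R]_(N.*2) :=
  \row_i let j : int := (i : nat)%:Z - N%:Z + 1 in
    (entry v j - entry v (j - 1)) / mesh R N.

Definition inner (R : realType) (N : nat) (v w : gridvec R N) : R :=
  \sum_i mesh R N * v 0 i * w 0 i.

(* Weighted l^p norm with mesh e; only meant for 1 <= p <= +oo. *)
Definition lpnorm (R : realType) (e : R) (p : \bar R) (m : nat) (x : 'rV[R]_m) : R :=
  match p with
  | EFin r => (e * \sum_i `|x 0 i| `^ r) `^ r^-1
  | +oo%E => \big[Num.max/0]_i `|x 0 i|
  | -oo%E => 0
  end.

(* {v in V_0 : |Dv|_p = 1} *)
Definition V0_unit (R : realType) (N : nat) (p : \bar R) : set (gridvec R N) :=
  [set v | V0 v /\ lpnorm (mesh R N) p (bdiff v) = 1].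
Arguments V0_unit {R} N p.

(* Main.v *)
Require Import Defs.
From HB Require Import structures.
From mathcomp Require Import all_boot all_order all_algebra.
From mathcomp Require Import all_classical all_reals all_analysis.
From mathcomp Require Import zify ring lra.

Import Order.TTheory GRing.Theory Num.Theory.

Local Open Scope classical_set_scope.
Local Open Scope ring_scope.

(** An explicit displacement u makes the infimum small.  It is even, equals
    N - |j| (times the mesh) in the continuum, and is constant in the atomistic
    region, so its gradient Du is 0 inside, -1 on the right and +1 on the left,
    except for the values -s and s of the gradient on the two bonds that join
    the regions.  A fixed fraction of the bonds carries a unit gradient, so
    the norm of Du is bounded below uniformly in N and K
    ([lpnorm_plateau_ge]).

    The operator vanishes on u away from the interfaces.  Near j = K it
    produces, up to the factor 1/epsilon, three forces

      alpha = (phiF + 4 phi2F) (1 - s)      at K+1,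
      beta  = phiF s + phi2F (1 + s)        at K,
      gamma = phi2F s                       at K-1,

    and the mirror images near -K ([Lqcf_plateau]).  The operator is not in
    divergence form, because atoms K and K-1 feel second neighbours across the
    interface while K+1 does not feel them.  Hence alpha + beta + gamma is
    phiF + 5 phi2F - 2 phi2F s, which as phi2F is nonzero vanishes for one
    choice of s: the jump of the gradient from 0 to -1 is then invisible to the
    operator in the bulk and balanced at the interface.

    Three forces with zero sum only see the increments of a test vector w
    between neighbours, so <L u, w> is a bounded combination of four of these
    ([inner_Lqcf_plateau]).  When Dw has unit q-norm a single component of Dw
    is at most epsilon^(-1/q), so an increment is at most
    epsilon^(1-1/q) = N^(-1/p) ([entry_step_le]). *)

(** * The plateau profile and its second differences *)

(** The height of the plateau is chosen so that the profile drops by s from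
    site K to site K + 1. *)
Definition plateau {R : realType} (s : R) (N K : nat) (j : int) : R :=
  if - K%:Z <= j <= K%:Z then N%:R - K%:R - 1 + s
  else if 0 <= j then N%:R - j%:~R else N%:R + j%:~R.

Definition sym_delta (R : realType) (c j : int) : R :=
  (j == c)%:R + (j == - c)%:R.

Ltac decide_tests :=
  repeat match goal with
  | |- context [if ?b then _ else _] =>
      first [rewrite (_ : b = true); last lia | rewrite (_ : b = false); last lia]
  | |- context [(nat_of_bool (?x == ?y))%:R] =>
      first [rewrite (_ : (x == y) = true); last lia
            | rewrite (_ : (x == y) = false); last lia]
  end; rewrite /= ?rmorphD ?rmorphB ?rmorphN /= -?pmulrn.

(** The second difference vanishes wherever the profile is affine on the
    stencil, which leaves only the ends of the two interface bonds. *)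
Lemma plateau_diff1 (R : realType) (s : R) (N K : nat) (j : int) : (2 <= K)%N ->
  - plateau s N K (j + 1) + 2 * plateau s N K j - plateau s N K (j - 1)
  = (1 - s) * sym_delta R (K%:Z + 1) j + s * sym_delta R K%:Z j.
Proof.
move=> K2; rewrite /plateau /sym_delta.
have : j < - K%:Z - 1 \/ j = - K%:Z - 1 \/ j = - K%:Z \/ - K%:Z < j < K%:Z \/
       j = K%:Z \/ j = K%:Z + 1 \/ K%:Z + 1 < j by lia.
by case=> [jK|[->|[->|[jK|[->|[->|jK]]]]]]; decide_tests; ring.
Qed.

(** The restriction to the atomistic region is essential: the second-neighbour
    stencil would also meet the interface from K+1 and K+2. *)
Lemma plateau_diff2 (R : realType) (s : R) (N K : nat) (j : int) : (2 <= K)%N ->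
  - K%:Z <= j <= K%:Z ->
  - plateau s N K (j + 2) + 2 * plateau s N K j - plateau s N K (j - 2)
  = (1 + s) * sym_delta R K%:Z j + s * sym_delta R (K%:Z - 1) j.
Proof.
move=> K2 jK; rewrite /plateau /sym_delta.
have : j = - K%:Z \/ j = - K%:Z + 1 \/ - K%:Z + 1 < j < K%:Z - 1 \/
       j = K%:Z - 1 \/ j = K%:Z by lia.
by case=> [->|[->|[jK1|[->|->]]]]; decide_tests; ring.
Qed.

(** * Reading entries of grid vectors *)

Lemma entryE (R : realType) (N : nat) (f : int -> R) (j : int) :
  - N%:Z <= j <= N%:Z ->
  entry (\row_i f ((i : nat)%:Z - N%:Z) : gridvec R N) j = f j.
Proof.
move=> jN; rewrite /entry mxE inordK; last by lia.
by congr f; lia.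
Qed.

(** Turns the sum over all positions into point evaluations, so that the
    inner product with a force of finite support becomes a finite expression. *)
Lemma sum_delta_entry (R : realType) (N : nat) (w : gridvec R N) (c : int) :
  - N%:Z <= c <= N%:Z ->
  \sum_(i < N.*2.+1) ((i : nat)%:Z - N%:Z == c)%:R * w 0 i = entry w c.
Proof.
move=> cN; rewrite (bigD1 (inord (absz (c + N%:Z)))) //= big1 => [|i ne].
  rewrite inordK; last by lia.
  by rewrite (_ : _ == _ = true) ?mul1r ?addr0 //; lia.
rewrite (_ : _ == _ = false) ?mul0r //; apply/negP => /eqP ic.
move/eqP: ne; apply; apply: val_inj; rewrite /= inordK; lia.
Qed.

Lemma sum_sym_delta_entry (R : realType) (N : nat) (w : gridvec R N) (c : int) :
  0 <= c <= N%:Z ->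
  \sum_(i < N.*2.+1) sym_delta R c ((i : nat)%:Z - N%:Z) * w 0 i =
  entry w c + entry w (- c).
Proof.
move=> cN; rewrite -!sum_delta_entry -?big_split /=; [|lia|lia].
by apply: eq_bigr => i _; rewrite /sym_delta mulrDl.
Qed.

(** * The operator applied to the plateau vector *)

Definition plateau_vec {R : realType} (a s : R) (N K : nat) : gridvec R N :=
  \row_i (a * mesh R N * plateau s N K ((i : nat)%:Z - N%:Z)).

Lemma plateau_vecE (R : realType) (a s : R) (N K : nat) (j : int) :
  - N%:Z <= j <= N%:Z ->
  entry (plateau_vec a s N K) j = a * mesh R N * plateau s N K j.
Proof. exact: (@entryE R N (fun j => a * mesh R N * plateau s N K j)). Qed.

(** The interface forces alpha, beta, gamma, for arbitrary s.  At the boundary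
    indices, where the operator is 0 by definition, the formula still holds
    because K + 1 < N. *)
Lemma Lqcf_plateau (R : realType) (phiF phi2F a s : R) (N K : nat)
    (i : 'I_N.*2.+1) : (2 <= K)%N -> (2 * K <= N)%N ->
  let j := (i : nat)%:Z - N%:Z in
  Lqcf phiF phi2F K (plateau_vec a s N K) 0 i =
  a / mesh R N *
    ((phiF + 4 * phi2F) * (1 - s) * sym_delta R (K%:Z + 1) j
     + (phiF * s + phi2F * (1 + s)) * sym_delta R K%:Z j
     + phi2F * s * sym_delta R (K%:Z - 1) j).
Proof.
move=> K2 KN j; rewrite mxE /= -/j.
have h0 : mesh R N != 0 by rewrite invr_eq0 pnatr_eq0; lia.
have ji : - N%:Z <= j <= N%:Z by have := ltn_ord i; rewrite /j; lia.
case: ifP => jN.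
  by rewrite /sym_delta; decide_tests; ring.
have d1 : neg_diff2 (plateau_vec a s N K) 1 j = a / mesh R N *
    ((1 - s) * sym_delta R (K%:Z + 1) j + s * sym_delta R K%:Z j).
  rewrite -(@plateau_diff1 _ _ N) // /neg_diff2 !plateau_vecE; [|lia..].
  by field.
case: ifP => jK; rewrite d1.
  have -> : neg_diff2 (plateau_vec a s N K) 2 j = a / mesh R N *
      ((1 + s) * sym_delta R K%:Z j + s * sym_delta R (K%:Z - 1) j).
    rewrite -(@plateau_diff2 _ _ N) // /neg_diff2 !plateau_vecE; [|lia..].
    by field.
  rewrite (_ : sym_delta R (K%:Z + 1) j = 0); first by ring.
  by rewrite /sym_delta; decide_tests; ring.
rewrite (_ : sym_delta R K%:Z j = 0); last by rewrite /sym_delta; decide_tests; ring.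
rewrite (_ : sym_delta R (K%:Z - 1) j = 0); first by ring.
by rewrite /sym_delta; decide_tests; ring.
Qed.

(** The condition on s says that the three forces at each interface sum to
    zero; summation by parts then leaves only increments of w. *)
Lemma inner_Lqcf_plateau (R : realType) (phiF phi2F a s : R) (N K : nat)
    (w : gridvec R N) : (2 <= K)%N -> (2 * K <= N)%N ->
  2 * phi2F * s = phiF + 5 * phi2F ->
  inner (Lqcf phiF phi2F K (plateau_vec a s N K)) w =
  a * ((phiF + 4 * phi2F) * (1 - s)
         * (entry w (K%:Z + 1) - entry w K%:Z
            - (entry w (- K%:Z) - entry w (- K%:Z - 1)))
       - phi2F * s * (entry w K%:Z - entry w (K%:Z - 1)
            - (entry w (- K%:Z + 1) - entry w (- K%:Z)))).
Proof.
move=> K2 KN hs.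
have h0 : mesh R N != 0 by rewrite invr_eq0 pnatr_eq0; lia.
have -> : inner (Lqcf phiF phi2F K (plateau_vec a s N K)) w =
  a * ((phiF + 4 * phi2F) * (1 - s)
         * (\sum_(i < N.*2.+1) sym_delta R (K%:Z + 1) ((i : nat)%:Z - N%:Z) * w 0 i)
       + (phiF * s + phi2F * (1 + s))
         * (\sum_(i < N.*2.+1) sym_delta R K%:Z ((i : nat)%:Z - N%:Z) * w 0 i)
       + phi2F * s
         * (\sum_(i < N.*2.+1) sym_delta R (K%:Z - 1) ((i : nat)%:Z - N%:Z) * w 0 i)).
  rewrite /inner !mulrDr !mulr_sumr -!big_split; apply: eq_bigr => i _ /=.
  by rewrite Lqcf_plateau //; field.
rewrite !sum_sym_delta_entry; [|lia..].
have -> : - (K%:Z + 1) = - K%:Z - 1 by lia.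
have -> : - (K%:Z - 1) = - K%:Z + 1 by lia.
have -> : phiF * s + phi2F * (1 + s) = - ((phiF + 4 * phi2F) * (1 - s)) - phi2F * s.
  by lra.
by ring.
Qed.

(** * Norm estimates *)

(** One term of the sum is at most the whole sum, so a coordinate is bounded by
    e^(-1/q); the extra factor e brings in the conjugate exponent. *)
Lemma coord_le_of_lpnorm (R : realType) (e p : R) (q : \bar R) (m : nat)
    (x : 'rV[R]_m) (i : 'I_m) : 0 < e -> (1 < q)%E ->
  (p%:E^-1 + q^-1 = 1)%E -> lpnorm e q x = 1 -> e * `|x 0 i| <= e `^ p^-1.
Proof.
move=> e0; case: q => [r|_|//] /=.
  rewrite lte_fin => r1; rewrite !inver.
  have r0 : r != 0 by lra.
  rewrite (negbTE r0); case: ifP => [//|p0] [] pr xr.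
  have {1}-> : e = e `^ p^-1 * e `^ r^-1.
    by rewrite -powRD ?pr ?oner_eq0 // powRr1 // ltW.
  rewrite -mulrA -[leRHS]mulr1 ler_wpM2l ?powR_ge0 // -xr.
  have {1}-> : `|x 0 i| = (`|x 0 i| `^ r) `^ r^-1.
    by rewrite -powRrM mulfV // powRr1.
  rewrite -powRM ?powR_ge0 ?(ltW e0) //.
  have s0 : 0 <= \sum_i `|x 0 i| `^ r by apply: sumr_ge0 => k _; apply: powR_ge0.
  apply: ge0_ler_powR; rewrite ?nnegrE ?invr_ge0 ?mulr_ge0 ?powR_ge0 ?(ltW e0) //.
    by lra.
  rewrite ler_wpM2l ?(ltW e0) // (bigD1 i) //= lerDl.
  by apply: sumr_ge0 => k _; apply: powR_ge0.
rewrite inver invey adde0; case: ifP => [//|p0] [] -> x1.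
rewrite powRr1 ?(ltW e0) // -[leRHS]mulr1 ler_wpM2l ?(ltW e0) // -x1.
exact: (@le_bigmax _ _ _ 0 (fun i => `|x 0 i|)).
Qed.

Lemma mesh_powR (R : realType) (N : nat) (t : R) :
  mesh R N `^ t = N%:R `^ (- t).
Proof. by rewrite /mesh -powR_inv1 // -powRrM mulN1r. Qed.

Lemma entry_step_le (R : realType) (p : R) (q : \bar R) (N : nat)
    (w : gridvec R N) (j : int) : (1 < q)%E -> (p%:E^-1 + q^-1 = 1)%E ->
  V0_unit N q w -> - N%:Z < j <= N%:Z ->
  `|entry w j - entry w (j - 1)| <= N%:R `^ (- p^-1).
Proof.
move=> q1 pq [_ w1] jN.
have h0 : 0 < mesh R N by rewrite invr_gt0 ltr0n; lia.
have iN : (absz (j + N%:Z - 1)%R < N.*2)%N by lia.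
have := coord_le_of_lpnorm _ _ _ _ _ _ (Ordinal iN) h0 q1 pq w1.
rewrite mxE /= mesh_powR (_ : _ + 1 = j); last by lia.
by rewrite normrM normfV (gtr0_norm h0) mulrCA mulfV ?gt_eqF // mulr1.
Qed.

Lemma lpnormZ (R : realType) (e p a : R) (m : nat) (x : 'rV[R]_m) :
  0 <= e -> 0 < p -> lpnorm e p%:E (a *: x) = `|a| * lpnorm e p%:E x.
Proof.
move=> e0 p0 /=.
have -> : \sum_i `|(a *: x) 0 i| `^ p = `|a| `^ p * \sum_i `|x 0 i| `^ p.
  by rewrite mulr_sumr; apply: eq_bigr => i _; rewrite mxE normrM powRM.
have s0 : 0 <= \sum_i `|x 0 i| `^ p by apply: sumr_ge0 => k _; apply: powR_ge0.
rewrite mulrCA [LHS]powRM ?powR_ge0 ?mulr_ge0 //.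
by rewrite -powRrM mulfV ?gt_eqF // powRr1.
Qed.

Lemma bdiff_plateau_vecE (R : realType) (a s : R) (N K : nat) (i : 'I_N.*2) :
  let j := (i : nat)%:Z - N%:Z + 1 in
  bdiff (plateau_vec a s N K) 0 i = a * (plateau s N K j - plateau s N K (j - 1)).
Proof.
have iN := ltn_ord i.
have h0 : mesh R N != 0 by rewrite invr_eq0 pnatr_eq0; lia.
by rewrite mxE /= !plateau_vecE; [field|lia..].
Qed.

Lemma bdiff_plateau_vecZ (R : realType) (a s : R) (N K : nat) :
  bdiff (plateau_vec a s N K) = a *: bdiff (plateau_vec 1 s N K).
Proof. by apply/rowP => i; rewrite [RHS]mxE !bdiff_plateau_vecE mul1r. Qed.

(** The gradient has absolute value 1 on the N - K - 1 bonds of the right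
    continuum region, and N - K - 1 >= N / 4.  Hence the p-th power of the norm
    is at least 1/4, and taking the p-th root of a number below 1 does not
    decrease it. *)
Lemma lpnorm_plateau_ge (R : realType) (p s : R) (N K : nat) : 1 <= p ->
  (2 <= K)%N -> (2 * K <= N)%N ->
  4^-1 <= lpnorm (mesh R N) p%:E (bdiff (plateau_vec 1 s N K)).
Proof.
move=> p1 K2 KN /=.
have h0 : 0 < mesh R N by rewrite invr_gt0 ltr0n; lia.
have p0 : p != 0 by lra.
have [pV0 pV1] : 0 <= p^-1 /\ p^-1 <= 1 by rewrite invr_ge0 invf_le1; lra.
set S := \sum_i _.
have S4 : 4^-1 <= mesh R N * S.
  have SN : (N - K.+1)%:R <= S.
    (* Position i holds bond i - N + 1, which lies beyond the interface bond
       K + 1 exactly when N + K + 1 <= i. *)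
    apply: (@le_trans _ _ (\sum_(i < N.*2) (N + K.+1 <= i)%N%:R)).
      rewrite -(big_mkord xpredT (fun i => (N + K.+1 <= i)%N%:R)).
      rewrite (@big_cat_nat _ _ _ (N + K.+1)) //=; last by lia.
      rewrite [X in X + _]big_nat_cond big1 => [|i]; last first.
        by case/andP => /andP[_ iK] _; rewrite leqNgt iK.
      rewrite add0r big_nat_cond.
      rewrite (eq_bigr (fun=> 1)) => [|i /andP[/andP[-> _] _]] //.
      rewrite -big_nat_cond sumr_const_nat.
      by rewrite ler_nat; lia.
    apply: ler_sum => i _; case: leqP => iK; last exact: powR_ge0.
    have iN := ltn_ord i.
    rewrite bdiff_plateau_vecE /plateau; decide_tests.
    by rewrite (_ : 1 * _ = -1) ?normrN1 ?powR1 //; ring.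
  rewrite -(ler_pM2l (x := N%:R)) ?ltr0n; last by lia.
  rewrite mulrA mulfV ?mul1r; last by rewrite pnatr_eq0; lia.
  apply: le_trans SN; rewrite ler_pdivrMr // -natrM ler_nat; lia.
apply: (@le_trans _ _ (4^-1 `^ p^-1)).
  rewrite -[leLHS]powRr1 //.
  by apply: ger_powR => //; apply/andP; split; lra.
by apply: ge0_ler_powR; rewrite // nnegrE; lra.
Qed.

Theorem theorem7p1 (R : realType) (phiF phi2F : R) (p : R) (q : \bar R)
    (hphiF : 0 < phiF) (hphi2F : phi2F != 0)
    (hp : 1 <= p) (hq : (1 < q)%E) (hpq : (p%:E^-1 + q^-1 = 1)%E) :
  exists C : R, 0 < C /\
    forall N K : nat, (2 <= K)%N -> (2 * K <= N)%N ->
      (ereal_inf [set ereal_sup [set (inner (Lqcf phiF phi2F K v) w)%:E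
                                | w in V0_unit N q]
                 | v in V0_unit N p%:E]
       <= (C * N%:R `^ (- p^-1))%:E)%E.
Proof.
(* The interface gradient that makes the three interface forces sum to zero. *)
set s := (phiF + 5 * phi2F) / (2 * phi2F).
have hs : 2 * phi2F * s = phiF + 5 * phi2F by rewrite /s; field.
set A := (phiF + 4 * phi2F) * (1 - s); set B := phi2F * s.
(* 8 is 4, from the lower bound 1/4 on the norm of the trial gradient, times 2,
   one increment of w at each of the two interfaces; the added 1 makes C
   positive. *)
exists (8 * (`|A| + `|B|) + 1); split.
  by rewrite ltr_wpDl // mulr_ge0 // addr_ge0.
move=> N K K2 KN.
set n := lpnorm (mesh R N) p%:E (bdiff (plateau_vec 1 s N K)).
have n4 : 4^-1 <= n by apply: lpnorm_plateau_ge.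
have n0 : 0 < n by apply: lt_le_trans n4; rewrite invr_gt0.
have vunit : V0_unit N p%:E (plateau_vec n^-1 s N K).
  split; last first.
    rewrite bdiff_plateau_vecZ lpnormZ ?invr_ge0 //; last by lra.
    by rewrite ger0_norm ?invr_ge0 ?(ltW n0) // mulVf ?gt_eqF.
  by split; (rewrite plateau_vecE /plateau; last lia); decide_tests; ring.
apply: le_trans (ereal_inf_lbound _) _; first by exists (plateau_vec n^-1 s N K).
apply: ge_ereal_sup => _ [w wunit <-]; rewrite lee_fin.
rewrite inner_Lqcf_plateau // -/A -/B.
set t := N%:R `^ (- p^-1).
have t0 : 0 <= t by apply: powR_ge0.
have step (j : int) : - N%:Z < j <= N%:Z -> `|entry w j - entry w (j - 1)| <= t.
  exact: entry_step_le hq hpq wunit.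
have := step (K%:Z + 1); have := step (K%:Z); have := step (- K%:Z).
have := step (- K%:Z + 1); rewrite !addrK.
set d1 := entry w (- K%:Z + 1) - _; set d2 := entry w (- K%:Z) - _.
set d3 := entry w K%:Z - _; set d4 := entry w (K%:Z + 1) - _.
move=> /(_ ltac:(lia)) h1 /(_ ltac:(lia)) h2 /(_ ltac:(lia)) h3 /(_ ltac:(lia)) h4.
have nV4 : n^-1 <= 4 by rewrite -[leRHS]invrK lef_pV2 ?posrE ?invr_gt0.
have h42 : `|d4 - d2| <= 2 * t by apply: le_trans (ler_normB _ _) _; lra.
have h31 : `|d3 - d1| <= 2 * t by apply: le_trans (ler_normB _ _) _; lra.
apply: (@le_trans _ _ (4 * ((`|A| + `|B|) * (2 * t)))); last by lra.
apply: le_trans (ler_norm _) _; rewrite normrM ger0_norm ?invr_ge0 ?(ltW n0) //.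
apply: ler_pM; rewrite ?invr_ge0 ?(ltW n0) //.
apply: le_trans (ler_normB _ _) _; rewrite (normrM A) (normrM B) [leRHS]mulrDl.
by apply: lerD; apply: ler_wpM2l.
Qed.
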